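(* Let $\widetilde{A}$ be the row-normalized adjacency matrix of a weighted directed graph with $N$ nodes. Suppose that all nodes have exponential waiting-time distributions, where node $i$ has rate parameter $\lambda_i>0$. Let $\Lambda$ be the diagonal matrix with entries $\Lambda_{ii}=\lambda_i$, let $I$ be the identity matrix, and let $Z=\Lambda(\widetilde{A}-I)$. If $Z$ is diagonalizable and irreducible, then the opinion model $$\dot{x}_i(t)=\lambda_i\sum_j\widetilde{A}_{ij}x_j(t)-\lambda_ix_i(t),\qquad i=1,\dots,N,$$ converges to consensus; that is, for every initial vector $x(0)\in\mathbb{R}^N$, there is a scalar $x_{\mathrm{same}}$ such that $\lim_{t\to\infty}x_i(t)=x_{\mathrm{same}}$ for all $i\in\{1,\dots,N\}$.
   Context: Graph: $A\in\mathbb{R}^{N\times N}$ is an adjacency matrix with nonnegative real entries ($A_{ij}$ is the weight of the edge from node $i$ to node $j$; self-edges are allowed), and each row sum of $A$ is larger than $0$. The row-normalized adjacency matrix is $\widetilde{A}_{ij}=A_{ij}/\sum_{l=1}^N A_{il}$. The displayed linear system of ordinary differential equations is the opinion model that is induced by the exponential waiting-time distributions $T_i(t)=\lambda_ie^{-\lambda_it}$; here $x_i(t)$ is the expected opinion of entity (node) $i$ at time $t\ge0$. Irreducible matrix: a square matrix that cannot be brought to block upper-triangular form (with more than one diagonal block) by a simultaneous permutation of its rows and columns; equivalently, the directed graph of its nonzero off-diagonal entries is strongly connected. *)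

(* Defs.v *)
From mathcomp Require Import all_boot all_order all_algebra all_fingroup.
From mathcomp Require Import complex.
From mathcomp Require Import all_classical all_reals all_analysis.
Import Order.TTheory GRing.Theory Num.Theory.
Import numFieldNormedType.Exports.

Set Implicit Arguments.
Unset Strict Implicit.
Unset Printing Implicit Defensive.

Local Open Scope classical_set_scope.
Local Open Scope ring_scope.

Definition adjacency (R : realType) (N : nat) (A : 'M[R]_N) : Prop :=
  (forall i j, 0 <= A i j) /\ (forall i, 0 < \sum_l A i l).

Definition row_normalize (R : realType) (N : nat) (A : 'M[R]_N) : 'M[R]_N :=
  \matrix_(i, j) (A i j / \sum_l A i l).

(* Block upper-triangular with two nonempty diagonal blocks, of sizes k and
   n - k; more blocks can always be merged into two. *)
Definition block_upper_triangular (R : realType) (n : nat) (A : 'M[R]_n)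
    : Prop :=
  exists k : nat, (0 < k < n)%N /\
    forall i j : 'I_n, (j < k <= i)%N -> A i j = 0.

Definition irreducible_mx (R : realType) (n : nat) (A : 'M[R]_n) : Prop :=
  forall s : 'S_n, ~ block_upper_triangular (row_perm s (col_perm s A)).

(* Diagonalizability of a real matrix is over the complex numbers: its
   eigenvalues need not be real. *)
Definition diagonalizable_over_C (R : realType) (n : nat) (A : 'M[R]_n)
    : Prop :=
  diagonalizable (map_mx (real_complex R) A).

(* The trajectory lives on [0, +oo[; its values at negative times are junk, so
   at time 0 only one-sided continuity is required. The equation then also
   holds at 0 for the right derivative. *)
Definition opinion_model (R : realType) (N : nat) (lam : 'I_N -> R)
    (At : 'M[R]_N) (x : R -> 'cV[R]_N) : Prop :=
  forall i : 'I_N,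
    {within `[0, +oo[, continuous (fun t : R => x t i ord0)} /\
    forall t : R, 0 < t ->
      is_derive t 1 (fun t : R => x t i ord0)
        (lam i * (\sum_j At i j * x t j ord0) - lam i * x t i ord0).

(* Main.v *)
(* The matrix Z has nonnegative off-diagonal entries and zero row sums, so that,
   being irreducible, it has a positive left null vector p.  Along a trajectory
   the p-weighted sum of the opinions is conserved; let y be the deviation from
   the corresponding mean and V = sum_i p_i y_i^2.  Then
   V' = - D with D = sum_(i,j) p_i Z_ij (y_i - y_j)^2, and strong connectivity
   gives a Poincare inequality c V <= D with c > 0.  Hence (1 + c t) V(t) is
   nonincreasing and V(t) tends to 0. *)

Require Import Defs.
From mathcomp Require Import all_boot all_order all_algebra all_fingroup.
From mathcomp Require Import complex.
From mathcomp Require Import zify ring lra.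
From mathcomp Require Import all_classical all_reals all_analysis.
Import Order.TTheory GRing.Theory Num.Theory.
Import numFieldNormedType.Exports.

Local Open Scope classical_set_scope.
Local Open Scope ring_scope.

(** * Irreducibility and the positive left null vector *)

(** If no edge left [S], listing the complement of [S] before [S] would put a zero block below the
    diagonal. *)
Lemma irreducible_boundary {R : realType} {n : nat} {Q : 'M[R]_n}
    {S : {set 'I_n}} :
  irreducible_mx Q -> S != finset.set0 -> S != [set: 'I_n]%SET ->
  exists i j, [/\ i \in S, j \notin S & Q i j != 0].
Proof.
move=> irrQ S0 ST; apply: contrapT => noedge.
have Q0 i j : i \in S -> j \notin S -> Q i j = 0.
  move=> iS jS; apply/eqP; apply: contraT => Qij.
  by case: noedge; exists i, j.
pose l := enum (~: S)%SET ++ enum S.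
have l_uniq : uniq l.
  rewrite cat_uniq !enum_uniq andbT /=; apply/hasPn => i.
  by rewrite !mem_enum inE negbK.
have l_size : size l = n by rewrite size_cat -!cardE addnC cardsC card_ord.
pose f (i : 'I_n) := nth i l i.
have f_inj : injective f.
  move=> i j; rewrite /f (set_nth_default i j) ?l_size// => /eqP.
  by rewrite nth_uniq ?l_size// => /eqP/val_inj.
have nE : (#|S| + #|(~: S)%SET| = n)%N by rewrite cardsC card_ord.
have S_gt0 : (0 < #|S|)%N by rewrite card_gt0.
have SC_gt0 : (0 < #|(~: S)%SET|)%N.
  by rewrite card_gt0 -(inj_eq (can_inj finset.setCK)) finset.setCK finset.setC0.
apply: (irrQ (perm f_inj)); exists #|(~: S)%SET|; split; first by lia.
move=> i j /andP[jk ki]; rewrite !mxE !permE; apply: Q0.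
  rewrite /f nth_cat -cardE ltnNge ki /= -mem_enum mem_nth //.
  by rewrite -cardE ltn_subLR// addnC nE ltn_ord.
by rewrite /f nth_cat -cardE jk -finset.in_setC -mem_enum mem_nth// -cardE.
Qed.

(** The rate matrix of a continuous-time Markov chain; the zero row sums fix its diagonal. *)
Definition generator {R : realType} {n : nat} (Q : 'M[R]_n) : Prop :=
  (forall i j, i != j -> 0 <= Q i j) /\ (forall i, \sum_j Q i j = 0).

(** An edge from [i] to [j] leaving the support of [p] would give a positive term in the [j]-th
    equation, whose terms are all nonnegative because [p j = 0] kills the diagonal one. *)
Lemma nonneg_stationary_pos {R : realType} {n : nat} {Q : 'M[R]_n}
    {p : 'I_n -> R} :
  generator Q -> irreducible_mx Q -> (forall i, 0 <= p i) ->
  (exists i, p i != 0) -> (forall j, \sum_i p i * Q i j = 0) ->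
  forall i, 0 < p i.
Proof.
move=> [Qge0 Qsum] irrQ p0 [i0 pi0] pQ.
pose S := [set i | p i != 0]%SET.
suff ST : S = [set: 'I_n]%SET.
  by move=> i; rewrite lt0r p0 andbT; have := finset.in_setT i; rewrite -ST inE.
apply: contrapT => /eqP ST.
have S0 : S != finset.set0 by apply/set0Pn; exists i0; rewrite inE.
have [i [j [iS jS /eqP]]] := irreducible_boundary irrQ S0 ST; apply.
have pj : p j = 0 by apply/eqP; move: jS; rewrite inE negbK.
have pos k : true -> 0 <= p k * Q k j.
  have [->|kj _] := eqVneq k j; first by rewrite pj mul0r.
  by rewrite mulr_ge0// Qge0.
have /eqP := psumr_eq0P pos (pQ j) (i := i) isT.
by move: iS; rewrite mulf_eq0 inE => /negPf -> /eqP.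
Qed.

(* Taking absolute values in a null row vector v of Q can only increase each
   entry of v Q above 0, whereas the entries of |v| Q sum to 0. *)
Lemma stationary_exists {R : realType} {n : nat} {Q : 'M[R]_n} :
  (0 < n)%N -> generator Q -> irreducible_mx Q ->
  exists p : 'I_n -> R,
    (forall i, 0 < p i) /\ (forall j, \sum_i p i * Q i j = 0).
Proof.
move=> n0 genQ irrQ; have [Qge0 Qsum] := genQ.
have /det0P[v v0 vQ] : \det Q == 0.
  (* Zero row sums make the all-ones row a left null vector of the transpose. *)
  rewrite -det_tr; apply/det0P; exists (const_mx 1).
    apply/eqP => /matrixP /(_ ord0 (Ordinal n0)); rewrite !mxE.
    by apply/eqP; rewrite oner_eq0.
  apply/rowP => i; rewrite !mxE -[RHS](Qsum i).
  by apply: eq_bigr => j _; rewrite !mxE mul1r.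
pose p i := `|v ord0 i|.
have nonneg j : true -> 0 <= \sum_i p i * Q i j.
  move=> _; have /rowP/(_ j) := vQ; rewrite !mxE (bigD1 j)//= => /eqP.
  rewrite addr_eq0 => /eqP vj.
  rewrite (bigD1 j)//= -lerBlDl sub0r.
  (* By this sign, the diagonal term is minus the absolute value of the off-diagonal part of the
     [j]-th entry of [v Q]; the triangle inequality then bounds it. *)
  have Qj : Q j j <= 0.
    have := Qsum j; rewrite (bigD1 j)//= => /eqP; rewrite addr_eq0 => /eqP ->.
    by rewrite oppr_le0; apply: sumr_ge0 => i ij; rewrite Qge0// eq_sym.
  rewrite -mulrN -[- Q j j]ger0_norm ?oppr_ge0// normrN /p -normrM vj normrN.
  apply: le_trans (ler_norm_sum _ _ _) _; apply: ler_sum => i ij.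
  by rewrite normrM (ger0_norm (Qge0 _ _ ij)).
have total : \sum_j \sum_i p i * Q i j = 0.
  rewrite exchange_big big1// => i _.
  by rewrite -mulr_sumr Qsum mulr0.
have pQ j : \sum_i p i * Q i j = 0 by exact: (psumr_eq0P nonneg total).
exists p; split=> //; apply: (nonneg_stationary_pos genQ irrQ) => //.
- by move=> i; rewrite normr_ge0.
- apply: contrapT => pz; case/eqP: v0; apply/rowP => i; rewrite !mxE.
  apply/eqP; apply: contraT => vi; case: pz; exists i.
  by rewrite normr_eq0.
Qed.

(** * The Poincare inequality *)

Definition second_moment {R : realType} {n : nat} (p y : 'I_n -> R) : R :=
  \sum_i p i * y i ^+ 2.

(** Up to a factor, the Dirichlet form of [Q] with weights [p]. The diagonal entries of [Q] multiply
    a zero difference. *)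
Definition dissipation {R : realType} {n : nat} (p : 'I_n -> R) (Q : 'M[R]_n)
    (y : 'I_n -> R) : R :=
  \sum_i \sum_j p i * Q i j * (y i - y j) ^+ 2.

Section Poincare.
Context {R : realType} {n : nat} (Q : 'M[R]_n) (p : 'I_n -> R).
Hypotheses (genQ : generator Q) (irrQ : irreducible_mx Q).
Hypothesis p_gt0 : forall i, 0 < p i.

Lemma dissipation_term_ge0 (y : 'I_n -> R) i j :
  0 <= p i * Q i j * (y i - y j) ^+ 2.
Proof.
have [->|ij] := eqVneq i j; first by rewrite subrr expr0n mulr0.
by rewrite mulr_ge0 ?sqr_ge0// mulr_ge0 ?(ltW (p_gt0 _))// genQ.1.
Qed.

Lemma dissipation_ge0 (y : 'I_n -> R) : 0 <= dissipation p Q y.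
Proof. by do 2!apply: sumr_ge0 => ? _; exact: dissipation_term_ge0. Qed.

Lemma term_le_dissipation (y : 'I_n -> R) i j :
  p i * Q i j * (y i - y j) ^+ 2 <= dissipation p Q y.
Proof.
rewrite /dissipation (bigD1 i)//= (bigD1 j)//= -addrA lerDl addr_ge0//.
  by apply: sumr_ge0 => ? _; exact: dissipation_term_ge0.
by do 2!apply: sumr_ge0 => ? _; exact: dissipation_term_ge0.
Qed.

(* The pairs (i, j) for which such a K exists form a transitive relation that
   contains every edge of Q. *)
Lemma sqr_diff_le_dissipation i j :
  exists K : R, 0 <= K /\
    forall y : 'I_n -> R, (y i - y j) ^+ 2 <= K * dissipation p Q y.
Proof.
pose rel j := exists K : R, 0 <= K /\
  forall y : 'I_n -> R, (y i - y j) ^+ 2 <= K * dissipation p Q y.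
pose S := [set j | `[< rel j >]]%SET.
suff ST : S = [set: 'I_n]%SET.
  by have := finset.in_setT j; rewrite -ST inE => /asboolP.
apply: contrapT => /eqP ST.
have S0 : S != finset.set0.
  apply/set0Pn; exists i; rewrite inE; apply/asboolP; exists 0; split=> // y.
  by rewrite subrr expr0n mul0r.
have [k [l [kS lS Qkl]]] := irreducible_boundary irrQ S0 ST.
have kl : k != l by apply: contraNneq lS => <-.
move: lS; rewrite inE => /asboolP; apply.
move: kS; rewrite inE => /asboolP[K [K0 hK]].
have w_gt0 : 0 < p k * Q k l by rewrite mulr_gt0// lt0r Qkl genQ.1.
(* From [(a + b)^2 <= 2 a^2 + 2 b^2], with [K] for the path to [k] and a single dissipation term for
   the edge from [k] to [l]. *)
exists (2 * K + 2 / (p k * Q k l)); split.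
  by rewrite addr_ge0 ?mulr_ge0// invr_ge0 ltW.
move=> y; have hkl : (y k - y l) ^+ 2 <= (p k * Q k l)^-1 * dissipation p Q y.
  by rewrite ler_pdivlMl// term_le_dissipation.
have := hK y; have := sqr_ge0 ((y i - y k) - (y k - y l)).
rewrite mulrDl; nra.
Qed.

(** For mean-zero [y] the second moment is, up to the factor [2 P], the weighted sum of all squared
    differences, and each of these is controlled by the dissipation. *)
Lemma second_moment_le_dissipation :
  exists c : R, 0 < c /\ forall y : 'I_n -> R, \sum_i p i * y i = 0 ->
    c * second_moment p y <= dissipation p Q y.
Proof.
have [n0|n_gt0] := posnP n.
  exists 1; split=> // y _; rewrite mul1r /second_moment big1 ?dissipation_ge0//.
  by move=> i; have := ltn_ord i; rewrite [X in (_ < X)%N]n0.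
pose K i j := sval (cid (sqr_diff_le_dissipation i j)).
have K_ge0 i j : 0 <= K i j by rewrite /K; case: cid => ? [].
have KP i j y : (y i - y j) ^+ 2 <= K i j * dissipation p Q y.
  by rewrite /K; case: cid => ? [].
pose M := \sum_i \sum_j p i * p j * K i j.
have M_ge0 : 0 <= M.
  apply: sumr_ge0 => i _; apply: sumr_ge0 => j _.
  by rewrite !mulr_ge0// ltW.
pose P := \sum_i p i.
have P_gt0 : 0 < P.
  rewrite /P (bigD1 (Ordinal n_gt0))//= ltr_pwDl// sumr_ge0// => i _.
  exact: ltW.
(* Only [M >= 0] is known, hence the [+ 1] in the denominator. *)
exists (P / (M + 1)); split; first by rewrite divr_gt0// ltr_wpDl.
move=> y y0.
have id : \sum_i \sum_j p i * p j * (y i - y j) ^+ 2 = 2 * P * second_moment p y.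
  transitivity (\sum_i (p i * y i ^+ 2 * P - 2 * p i * y i * (\sum_j p j * y j)
      + p i * second_moment p y)).
    apply: eq_bigr => i _; rewrite /P /second_moment !mulr_sumr -sumrB -big_split/=.
    by apply: eq_bigr => j _; ring.
  rewrite y0 big_split/= -mulr_suml.
  under eq_bigr do rewrite mulr0 subr0.
  by rewrite -mulr_suml -/P /second_moment; ring.
have le : 2 * P * second_moment p y <= M * dissipation p Q y.
  rewrite -id /M mulr_suml; apply: ler_sum => i _.
  rewrite mulr_suml; apply: ler_sum => j _.
  by rewrite -[leRHS]mulrA ler_wpM2l// mulr_ge0// ltW.
have V_ge0 : 0 <= second_moment p y.
  by apply: sumr_ge0 => i _; rewrite mulr_ge0 ?sqr_ge0// ltW.
rewrite mulrAC ler_pdivrMr ?ltr_wpDl// mulrC.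
have := dissipation_ge0 y; have := mulr_ge0 (ltW P_gt0) V_ge0; nra.
Qed.
End Poincare.

(** * Conservation and decay along the flow *)

(** Row sums and stationarity allow subtracting [p i * Q i j * y i ^+ 2] and
    [p i * Q i j * y j ^+ 2], which both sum to zero; this completes the square. *)
Lemma second_moment_derivativeE {R : realType} {n : nat} {Q : 'M[R]_n}
    {p : 'I_n -> R} (y : 'I_n -> R) :
  (forall i, \sum_j Q i j = 0) -> (forall j, \sum_i p i * Q i j = 0) ->
  \sum_i p i * (2 * y i * \sum_j Q i j * y j) = - dissipation p Q y.
Proof.
move=> Qsum pQ; rewrite /dissipation.
transitivity (\sum_i (p i * (2 * y i * \sum_j Q i j * y j)
   - p i * y i ^+ 2 * \sum_j Q i j) - \sum_j y j ^+ 2 * \sum_i p i * Q i j).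
  rewrite [X in _ - X]big1; last by move=> j _; rewrite pQ mulr0.
  by rewrite subr0; apply: eq_bigr => i _; rewrite Qsum mulr0 subr0.
under [X in _ - X]eq_bigr do rewrite mulr_sumr.
rewrite exchange_big -sumrB -sumrN; apply: eq_bigr => i _ /=.
rewrite !mulr_sumr -!sumrB -sumrN; apply: eq_bigr => j _; ring.
Qed.

Lemma within_continuous_weighted_sum {R : realType} {A : set R} {n : nat}
    (p : 'I_n -> R) (g : 'I_n -> R -> R) :
  (forall i, {within A, continuous (g i)}) ->
  {within A, continuous (\sum_i cst (p i) * g i)}.
Proof.
move=> cg; elim/big_ind: _ => [|f h|i _]; first by move=> x; exact: cvg_cst.
  exact: within_continuousD.
by move=> x; apply: cvgM; [exact: cvg_cst|exact: cg].
Qed.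

(** The mean value theorem on [[0, t]] asks for derivatives only in the open interval, so one-sided
    continuity at 0 suffices. *)
Lemma nonpos_derive_le0 {R : realType} {f df : R -> R} :
  {within `[0, +oo[, continuous f} ->
  (forall t : R, 0 < t -> is_derive t 1 f (df t)) ->
  (forall t : R, 0 < t -> df t <= 0) ->
  forall t : R, 0 <= t -> f t <= f 0.
Proof.
move=> cf dfE df_le0 t; rewrite le_eqVlt => /predU1P[<-//|t_gt0].
have df_itv s : s \in `]0, t[ -> is_derive s 1 f (df s).
  by rewrite in_itv/= => /andP[/dfE].
have cf_itv : {within `[0, t], continuous f}.
  by apply: (continuous_subspaceW _ cf) => s; rewrite /= !in_itv/= => /andP[->].
have [s] := MVT t_gt0 df_itv cf_itv.
rewrite in_itv/= => /andP[s_gt0 _] ftE.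
by rewrite -subr_le0 ftE subr0 mulr_le0_ge0 ?df_le0// ltW.
Qed.

Section Flow.
Context {R : realType} {n : nat} (Q : 'M[R]_n) (y : 'I_n -> R -> R).
Hypothesis cont_y : forall i, {within `[0, +oo[, continuous (y i)}.
Hypothesis deriv_y : forall i (t : R), 0 < t ->
  is_derive t 1 (y i) (\sum_j Q i j * y j t).

Lemma weighted_sum_const (p : 'I_n -> R) :
  (forall j, \sum_i p i * Q i j = 0) ->
  forall t : R, 0 <= t -> \sum_i p i * y i t = \sum_i p i * y i 0.
Proof.
(* The weights may have any sign, so the bound applies to both [p] and [- p] and yields equality. *)
have le (q : 'I_n -> R) : (forall j, \sum_i q i * Q i j = 0) ->
    forall t : R, 0 <= t -> \sum_i q i * y i t <= \sum_i q i * y i 0.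
  move=> qQ; pose f := \sum_i (cst (q i) * y i).
  have fE t : f t = \sum_i q i * y i t by rewrite /f fct_sumE.
  move=> t t_ge0; rewrite -!fE; move: t t_ge0.
  apply: (@nonpos_derive_le0 _ f (fun=> 0)) => // [|t t_gt0].
    exact: within_continuous_weighted_sum.
  have df := is_derive_sum (fun i =>
    is_deriveM (is_derive_cst (q i) t 1) (deriv_y i t t_gt0)).
  apply: (is_derive_eq df).
  transitivity (\sum_j y j t * \sum_i q i * Q i j); last first.
    by rewrite big1// => j _; rewrite qQ mulr0.
  under [RHS]eq_bigr do rewrite mulr_sumr.
  rewrite exchange_big; apply: eq_bigr => i _ /=.
  rewrite scaler0 addr0 /cst scaler_sumr; apply: eq_bigr => j _.
  by rewrite /GRing.scale/=; ring.
move=> pQ t t_ge0; apply/le_anti; rewrite le// /=.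
have sumN (z : 'I_n -> R) : \sum_i - p i * z i = - \sum_i p i * z i.
  by rewrite -sumrN; apply: eq_bigr => i _; rewrite mulNr.
have NpQ j : \sum_i - p i * Q i j = 0 by rewrite sumN pQ oppr0.
by have := le _ NpQ t t_ge0; rewrite !sumN lerN2.
Qed.

Lemma mean_zero_cvg0 (p : 'I_n -> R) :
  generator Q -> irreducible_mx Q -> (forall i, 0 < p i) ->
  (forall j, \sum_i p i * Q i j = 0) -> \sum_i p i * y i 0 = 0 ->
  forall i, y i t @[t --> +oo] --> 0.
Proof.
move=> genQ irrQ p_gt0 pQ y0.
have [c [c_gt0 poincare]] := second_moment_le_dissipation Q p genQ irrQ p_gt0.
pose V : R -> R := \sum_i (cst (p i) * y i ^+ 2).
have VE t : V t = second_moment p (y ^~ t) by rewrite /V fct_sumE.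
pose W : R -> R := (cst 1 + cst c * id) * V.
have WE t : W t = (1 + c * t) * V t by [].
have V_ge0 t : 0 <= V t.
  by rewrite VE; apply: sumr_ge0 => i _; rewrite mulr_ge0 ?sqr_ge0// ltW.
have cV : {within `[0, +oo[, continuous V}.
  apply: within_continuous_weighted_sum => i s.
  by rewrite expr2; apply: cvgM; exact: cont_y.
have clin : {within `[0, +oo[, continuous (cst 1 + cst c * id : R -> R)}.
  apply: continuous_subspaceT => s.
  by apply: cvgD; [exact: cvg_cst|apply: cvgM; [exact: cvg_cst|exact: cvg_id]].
have decay (t : R) : 0 <= t -> (1 + c * t) * V t <= V 0.
  move=> t_ge0.
  rewrite -WE (_ : V 0 = W 0); last by rewrite WE mulr0 addr0 mul1r.
  move: t t_ge0; apply: (@nonpos_derive_le0 _ W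
    (fun t => c * V t - (1 + c * t) * dissipation p Q (y ^~ t))).
  - by move=> t; apply: cvgM; [exact: clin|exact: cV].
  - move=> t t_gt0.
    have dV := is_derive_sum (fun i => is_deriveM (is_derive_cst (p i) t 1)
      (is_deriveX 2 (deriv_y i t t_gt0))).
    have dlin := is_deriveD (is_derive_cst (1 : R) t 1)
      (is_deriveM (is_derive_cst c t 1) (is_derive_id t (1 : R))).
    apply: (is_derive_eq (is_deriveM dlin dV)).
    transitivity ((1 + c * t) * (- dissipation p Q (y ^~ t)) + V t * c).
      rewrite -(second_moment_derivativeE (y ^~ t) genQ.2 pQ).
      congr (_ * _ + _ * _).
        by apply: eq_bigr => i _; rewrite scaler0 addr0 expr1.
      by rewrite scaler0 addr0 add0r; exact: mulr1.
    by ring.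
  (* The mean stays zero, so the Poincare inequality holds at time [t], and
     [c V <= D <= (1 + c t) D]. *)
  - move=> t t_gt0; rewrite subr_le0.
    have mean0 : \sum_i p i * y i t = 0 by rewrite weighted_sum_const// ltW.
    have := poincare _ mean0; rewrite -VE => VD.
    rewrite (le_trans VD)// ler_peMl//.
      exact: le_trans (mulr_ge0 (ltW c_gt0) (V_ge0 t)) VD.
    by rewrite lerDl mulr_ge0// ltW.
move=> i; apply/cvgr0Pnorm_lt => e e_gt0.
have B_real : V 0 / (p i * e ^+ 2 * c) \is Num.real by exact: num_real.
near=> t.
have t_gt0 : 0 < t by near: t; exact: nbhs_pinfty_gt.
(* Beyond this time [e <= |y i t|] is impossible: it would give [c t p_i e^2 <= c t V t <= V 0]. *)
have tbig : V 0 / (p i * e ^+ 2 * c) < t.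
  by near: t; apply: nbhs_pinfty_gt.
have yV : p i * y i t ^+ 2 <= V t.
  rewrite VE /second_moment (bigD1 i)//= lerDl sumr_ge0// => j _.
  by rewrite mulr_ge0 ?sqr_ge0// ltW.
rewrite ltNge; apply/negP => ley.
have le2 : e ^+ 2 <= y i t ^+ 2.
  by rewrite -(real_normK (num_real (y i t))) ler_pXn2r// nnegrE ltW.
have peV : p i * e ^+ 2 <= V t.
  by apply: le_trans yV; rewrite ler_wpM2l// ltW.
have pe_gt0 : 0 < p i * e ^+ 2 by rewrite mulr_gt0// exprn_gt0.
move: tbig; rewrite ltr_pdivrMr ?mulr_gt0//.
have := decay _ (ltW t_gt0).
have := ler_wpM2l (mulr_ge0 (ltW c_gt0) (ltW t_gt0)) peV.
have := V_ge0 t; nra.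
Unshelve. all: by end_near. Qed.
End Flow.

(** * The opinion model as the flow of a generator *)

Section OpinionModel.
Context {R : realType} {N : nat} (A : 'M[R]_N) (lam : 'I_N -> R).
Hypotheses (hA : adjacency A) (hlam : forall i, 0 < lam i).

Let Z := diag_mx (\row_i lam i) *m (row_normalize A - 1%:M).

Lemma opinion_generatorE i j :
  Z i j = lam i * row_normalize A i j - lam i * (i == j)%:R.
Proof. by rewrite /Z mul_diag_mx !mxE mulrBr. Qed.

Lemma row_normalize_sum1 i : \sum_j row_normalize A i j = 1.
Proof.
under eq_bigr do rewrite mxE.
by rewrite -mulr_suml divff// gt_eqF// hA.2.
Qed.

Lemma opinion_flowE (z : 'I_N -> R) i :
  lam i * (\sum_j row_normalize A i j * z j) - lam i * z i =
  \sum_j Z i j * z j.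
Proof.
under [RHS]eq_bigr do rewrite opinion_generatorE mulrBl.
rewrite sumrB mulr_sumr; congr (_ - _).
  by apply: eq_bigr => j _; rewrite mulrA.
rewrite (bigD1 i)//= eqxx mulr1 big1 ?addr0// => j ji.
by rewrite eq_sym (negPf ji) mulr0 mul0r.
Qed.

Lemma opinion_generator : generator Z.
Proof.
split=> [i j ij|i].
  rewrite opinion_generatorE (negPf ij) mulr0 subr0 mulr_ge0 ?(ltW (hlam _))//.
  by rewrite mxE divr_ge0 ?hA.1// ltW// hA.2.
(* A row sum is the flow evaluated at the constant opinion 1. *)
transitivity (\sum_j Z i j * 1); first by apply: eq_bigr => j _; rewrite mulr1.
rewrite -(opinion_flowE (fun=> 1)).
under eq_bigr do rewrite mulr1.
by rewrite row_normalize_sum1 subrr.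
Qed.

End OpinionModel.

Theorem corollary2p8 (R : realType) (N : nat) (A : 'M[R]_N) (lam : 'I_N -> R)
    (hA : adjacency A) (hlam : forall i, 0 < lam i) :
  let At := row_normalize A in
  let Lambda := diag_mx (\row_i lam i) in
  let Z := Lambda *m (At - 1%:M) in
  diagonalizable_over_C Z ->
  irreducible_mx Z ->
  forall x0 : 'cV[R]_N, exists x_same : R,
    forall x : R -> 'cV[R]_N, opinion_model lam At x -> x 0 = x0 ->
      forall i : 'I_N, x t i ord0 @[t --> +oo] --> x_same.
Proof.
move=> At Lambda Z _ irrZ x0.
have [N0|N_gt0] := posnP N.
  by exists 0 => x _ _ i; have := ltn_ord i; rewrite [X in (_ < X)%N]N0.
have genZ : generator Z := opinion_generator A lam hA hlam.
have [p [p_gt0 pZ]] := stationary_exists N_gt0 genZ irrZ.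
have P_neq0 : \sum_i p i != 0.
  rewrite gt_eqF// (bigD1 (Ordinal N_gt0))//= ltr_pwDl// sumr_ge0// => i _.
  exact: ltW.
(* The consensus value is the conserved [p]-weighted mean; it depends on [x0] alone, so it is fixed
   before the trajectory. *)
pose m := (\sum_i p i * x0 i ord0) / \sum_i p i.
exists m => x model xx0.
pose y i (t : R) := x t i ord0 - m.
have cont_y i : {within `[0, +oo[, continuous (y i)}.
  by move=> t; apply: cvgB; [exact: (model i).1|exact: cvg_cst].
(* [Z] annihilates constants, so the deviation from [m] solves the same system. *)
have deriv_y i (t : R) : 0 < t -> is_derive t 1 (y i) (\sum_j Z i j * y j t).
  move=> t_gt0.
  apply: (is_derive_eq (is_deriveB ((model i).2 t t_gt0) (is_derive_cst m t 1))).
  rewrite subr0 opinion_flowE.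
  under [RHS]eq_bigr do rewrite mulrBr.
  by rewrite sumrB -mulr_suml genZ.2 mul0r subr0.
have y0 : \sum_i p i * y i 0 = 0.
  rewrite /y xx0; under eq_bigr do rewrite mulrBr.
  by rewrite sumrB -mulr_suml /m mulrCA divff// mulr1 subrr.
move=> i; apply/subr_cvg0.
exact: (mean_zero_cvg0 Z y cont_y deriv_y p).
Qed.
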